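(* Let $k \in \mathbb{N}$. Every linear $k$-DCFG $G$ is equivalent to (i.e. generates the same language as) some $k$-DCFG $G'=\langle N, \Sigma, P, S\rangle$ all of whose rules have one of the following forms, where $A, B \in N$ and $u \in \Theta$: (1) $A \to u\cdot B$ or $A \to B \cdot u$, with $|u| = 1$; (2) $A \to B \odot_j u$, with $|u| = 1$; (3) $A \to u$, with $|u| = 1$; (4) $S \to \epsilon$ (where $S$ is the start symbol).
   Context: Fix a finite alphabet $\Sigma$; $\Sigma^*$ is the set of words over $\Sigma$ and $\epsilon$ the empty word. $\Theta_k$ is the set of tuples $(u_0,\ldots,u_k)$ with $u_i\in\Sigma^*$, and $\Theta=\bigcup_{k\in\mathbb{N}}\Theta_k$; the rank of $(u_0,\ldots,u_k)$ is $k$, and its length $|u|$ is the sum of the lengths of its components. Rank-$0$ tuples are identified with words; in particular $\epsilon$ also denotes the rank-$0$ tuple $(\epsilon)$. Concatenation $\cdot:\Theta_i\times\Theta_j\to\Theta_{i+j}$ is $(x_0,\ldots,x_i)\cdot(y_0,\ldots,y_j)=(x_0,\ldots,x_{i-1},x_iy_0,y_1,\ldots,y_j)$, and for $1\le l\le i$ intercalation $\odot_l:\Theta_i\times\Theta_j\to\Theta_{i+j-1}$ is $(x_0,\ldots,x_i)\odot_l(y_0,\ldots,y_j)=(x_0,\ldots,x_{l-2},x_{l-1}y_0,y_1,\ldots,y_{j-1},y_jx_l,x_{l+1},\ldots,x_i)$. Let $N$ be a finite set of nonterminals disjoint from $\Sigma$ with a rank function $\mathrm{rk}:N\to\mathbb{N}$.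 The set of $k$-correct terms $\mathrm{Tm}_k(N,\Sigma)$ and their ranks are defined inductively: every tuple in $\Theta_j$ with $j\le k$ is a term of rank $j$, and every nonterminal $A$ with $\mathrm{rk}(A)\le k$ is a term of rank $\mathrm{rk}(A)$; if $\alpha,\beta$ are terms with $\mathrm{rk}\,\alpha+\mathrm{rk}\,\beta\le k$ then $(\alpha\cdot\beta)$ is a term of rank $\mathrm{rk}\,\alpha+\mathrm{rk}\,\beta$; if $1\le j\le k$, $\mathrm{rk}\,\alpha\ge j$ and $\mathrm{rk}\,\alpha+\mathrm{rk}\,\beta\le k+1$ then $(\alpha\odot_j\beta)$ is a term of rank $\mathrm{rk}\,\alpha+\mathrm{rk}\,\beta-1$. A ground term is one containing no nonterminals; its value $\nu(\alpha)\in\Theta$ is obtained by interpreting $\cdot$ and $\odot_j$ as the operations above. A context $C[x]$ is a term with one leaf occurrence of a variable $x$ of some rank; $C[\beta]$ is the result of substituting a term $\beta$ of the same rank for $x$. A $k$-displacement context-free grammar ($k$-DCFG) is $G=\langle N,\Sigma,P,S\rangle$ where $S\in N$ has rank $0$ and $P$ is a finite set of rules $A\to\alpha$ with $A\in N$, $\alpha\in\mathrm{Tm}_k(N,\Sigma)$ and $\mathrm{rk}(A)=\mathrm{rk}(\alpha)$. Standing assumption: all tuples occurring as leaves of right-hand sides of rules have length at most $1$. Derivability $\vdash_G$ is the smallest reflexive transitive relation between nonterminals and terms such that $(B\to\beta)\in P$ and $A\vdash_G C[B]$ imply $A\vdash_G C[\beta]$ for any context $C$. $L_G(A)=\{\nu(\alpha)\mid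 A\vdash_G\alpha,\ \alpha \text{ ground}\}$ and $L(G)=L_G(S)$. Two grammars are equivalent if they generate the same language. A term is linear if it contains at most one occurrence of a nonterminal; a grammar is linear if the right-hand sides of all its rules are linear. All right-hand sides in the claim are required to be $k$-correct terms of the same rank as the left-hand side. *)

(* Defs.v *)
From Stdlib Require List.
From mathcomp Require Import all_boot.
Set Implicit Arguments. Unset Strict Implicit. Unset Printing Implicit Defensive.

Section DCFG.
Variables (Sigma : Type) (N : Type).

(* A tuple (u_0, ..., u_k) is represented as the pair (u_0, [:: u_1; ...; u_k]);
   this makes tuples nonempty by construction. *)
Definition tuple_ : Type := (seq Sigma * seq (seq Sigma))%type.

Definition trank (u : tuple_) : nat := size u.2.
Definition tlen (u : tuple_) : nat := size u.1 + sumn (map size u.2).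
Definition tseq (u : tuple_) : seq (seq Sigma) := u.1 :: u.2.
Definition tofseq (s : seq (seq Sigma)) : tuple_ := (head [::] s, behead s).
Definition teps : tuple_ := ([::], [::]).

Definition tcat (x y : tuple_) : tuple_ :=
  tofseq (belast x.1 x.2 ++ (last x.1 x.2 ++ y.1) :: y.2).

(* intercalation x (.)_l y = (x_0..x_{l-1}) . y . (x_l..x_i)
   = (x_0..x_{l-2}, x_{l-1} y_0, y_1..y_{j-1}, y_j x_l, x_{l+1}..x_i)
   (meaningful for 1 <= l <= rank x) *)
Definition tint (l : nat) (x y : tuple_) : tuple_ :=
  tcat (tcat (tofseq (take l (tseq x))) y) (tofseq (drop l (tseq x))).

Inductive term : Type :=
| Leaf of tuple_
| NT of N
| Cat of term & term
| Int of nat & term & term.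

Variable rk : N -> nat.

Fixpoint trk (t : term) : nat :=
  match t with
  | Leaf u => trank u
  | NT A => rk A
  | Cat a b => trk a + trk b
  | Int _ a b => (trk a + trk b).-1
  end.

Fixpoint correct (k : nat) (t : term) : bool :=
  match t with
  | Leaf u => trank u <= k
  | NT A => rk A <= k
  | Cat a b => [&& correct k a, correct k b & trk a + trk b <= k]
  | Int j a b => [&& correct k a, correct k b, 1 <= j <= k, j <= trk a
                   & trk a + trk b <= k.+1]
  end.

Fixpoint nocc (t : term) : nat :=
  match t with
  | Leaf _ => 0
  | NT _ => 1
  | Cat a b => nocc a + nocc b
  | Int _ a b => nocc a + nocc b
  end.

Definition ground (t : term) : bool := nocc t == 0.

(* value of a ground term (NT leaves are mapped to an arbitrary value) *)
Fixpoint nu (t : term) : tuple_ :=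
  match t with
  | Leaf u => u
  | NT _ => teps
  | Cat a b => tcat (nu a) (nu b)
  | Int j a b => tint j (nu a) (nu b)
  end.

Fixpoint leaves_ok (t : term) : bool :=
  match t with
  | Leaf u => tlen u <= 1
  | NT _ => true
  | Cat a b => leaves_ok a && leaves_ok b
  | Int _ a b => leaves_ok a && leaves_ok b
  end.

Inductive context : Type :=
| Hole
| CatL of context & term
| CatR of term & context
| IntL of nat & context & term
| IntR of nat & term & context.

Fixpoint plug (C : context) (t : term) : term :=
  match C with
  | Hole => t
  | CatL C' b => Cat (plug C' t) b
  | CatR a C' => Cat a (plug C' t)
  | IntL j C' b => Int j (plug C' t) b
  | IntR j a C' => Int j a (plug C' t)
  end.

End DCFG.

Arguments teps {Sigma}.
Arguments Leaf {Sigma N}.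
Arguments NT {Sigma N}.
Arguments Cat {Sigma N}.
Arguments Int {Sigma N}.
Arguments Hole {Sigma N}.

Record grammar (Sigma N : Type) := Grammar {
  rk : N -> nat;
  rules : seq (N * term Sigma N);
  start : N
}.

Section Grammar.
Variables (Sigma N : Type) (G : grammar Sigma N).

Inductive derives (A : N) : term Sigma N -> Prop :=
| der_refl : derives A (NT A)
| der_step : forall (C : context Sigma N) (B : N) (beta : term Sigma N),
    List.In (B, beta) (rules G) ->
    derives A (plug C (NT B)) -> derives A (plug C beta).

Definition langN (A : N) (u : tuple_ Sigma) : Prop :=
  exists alpha, derives A alpha /\ ground alpha /\ nu alpha = u.

Definition lang (u : tuple_ Sigma) : Prop := langN (start G) u.

(* G is a k-DCFG (including the standing assumption on leaves) *)
Definition is_DCFG (k : nat) : Prop :=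
  rk G (start G) = 0 /\
  forall A alpha, List.In (A, alpha) (rules G) ->
    [/\ correct (rk G) k alpha, trk (rk G) alpha = rk G A & leaves_ok alpha].

Definition linear_grammar : Prop :=
  forall A alpha, List.In (A, alpha) (rules G) -> nocc alpha <= 1.

Definition normal_rule (A : N) (alpha : term Sigma N) : Prop :=
  (exists (u : tuple_ Sigma) (B : N), tlen u = 1 /\
      (alpha = Cat (Leaf u) (NT B) \/ alpha = Cat (NT B) (Leaf u))) \/
  (exists (B : N) (j : nat) (u : tuple_ Sigma), tlen u = 1 /\
      alpha = Int j (NT B) (Leaf u)) \/
  (exists u : tuple_ Sigma, tlen u = 1 /\ alpha = Leaf u) \/
  (A = start G /\ alpha = Leaf teps).

Definition normal_form : Prop :=
  forall A alpha, List.In (A, alpha) (rules G) -> normal_rule A alpha.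

End Grammar.

(* Main.v *)
Require Import Defs.
From Stdlib Require Import Classical.
From mathcomp Require Import all_boot zify.

Set Implicit Arguments. Unset Strict Implicit. Unset Printing Implicit Defensive.

(** A tuple is a word over the alphabet extended by a separator.  Each linear
    rule decomposes into replacements of one separator by a word with at most
    one letter, without exceeding rank [k].  Since the derived words have rank
    0 in the end, each separator of an intermediate word may be marked, by
    guessing, as active (some letter will eventually be inserted there) or
    dead (it will vanish).  Erasing dead and outer separators and merging
    adjacent active ones turns steps without a letter into identities, and a
    step inserting a letter into a normal-form rule; the rank does not grow.
    The shape of this rule depends only on the pattern of the marked word, in
    which maximal blocks of letters are contracted, and patterns of bounded
    rank are finite in number.  The nonterminals of the normal form are the
    stages of the decomposed rules paired with patterns; its rules are all
    normal-form rules that are sound for the intended languages, so only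
    completeness needs an argument. *)

(** * Languages of nonterminals as a least fixed point *)

Section Semantics.
Variables (Sigma N : Type).
Implicit Types (L : N -> tuple_ Sigma -> Prop) (t : term Sigma N) (G : grammar Sigma N).

(** Denotational counterpart of derivability: closure of a family [L] under a rule reads
    [sat L alpha u -> L A u]. *)
Fixpoint sat L t (u : tuple_ Sigma) : Prop :=
  match t with
  | Leaf v => u = v
  | NT A => L A u
  | Cat a b => exists u1 u2, [/\ sat L a u1, sat L b u2 & u = tcat u1 u2]
  | Int j a b => exists u1 u2, [/\ sat L a u1, sat L b u2 & u = tint j u1 u2]
  end.

Lemma sat_mono L L' t u :
  (forall A v, L A v -> L' A v) -> sat L t u -> sat L' t u.
Proof.
move=> LL'; elim: t u => [v|A|a IHa b IHb|j a IHa b IHb] u //=; first exact: LL'.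
- by move=> [u1 [u2 [/IHa h1 /IHb h2 ->]]]; exists u1, u2.
- by move=> [u1 [u2 [/IHa h1 /IHb h2 ->]]]; exists u1, u2.
Qed.

Lemma sat_ground L t : ground t -> sat L t (nu t).
Proof.
rewrite /ground; elim: t => [v|A|a IHa b IHb|j a IHa b IHb] //=;
  rewrite addn_eq0 => /andP[/IHa ha /IHb hb].
- by exists (nu a), (nu b).
- by exists (nu a), (nu b).
Qed.

Lemma sat_groundE L t u : ground t -> sat L t u -> u = nu t.
Proof.
rewrite /ground; elim: t u => [v|A|a IHa b IHb|j a IHa b IHb] u //=;
  rewrite addn_eq0 => /andP[ga gb] [u1 [u2 [/(IHa _ ga)-> /(IHb _ gb)-> ->]]] //.
Qed.

Fixpoint ccomp (C D : context Sigma N) : context Sigma N :=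
  match C with
  | Hole => D
  | CatL C' b => CatL (ccomp C' D) b
  | CatR a C' => CatR a (ccomp C' D)
  | IntL j C' b => IntL j (ccomp C' D) b
  | IntR j a C' => IntR j a (ccomp C' D)
  end.

Lemma plug_ccomp C D t : plug (ccomp C D) t = plug C (plug D t).
Proof. by elim: C => //= [C -> b|a C ->|j C -> b|j a C ->]. Qed.

Lemma sat_plug L C s t u :
  (forall v, sat L s v -> sat L t v) -> sat L (plug C s) u -> sat L (plug C t) u.
Proof.
move=> st; elim: C u => [|C IH b|a C IH|j C IH b|j a C IH] u /=; first exact: st.
- by move=> [u1 [u2 [/IH ? ? ->]]]; exists u1, u2.
- by move=> [u1 [u2 [? /IH ? ->]]]; exists u1, u2.
- by move=> [u1 [u2 [/IH ? ? ->]]]; exists u1, u2.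
- by move=> [u1 [u2 [? /IH ? ->]]]; exists u1, u2.
Qed.

(** The induction principle for [langN]. A derivation is read backwards from its ground end; undoing
    a rewriting step preserves satisfaction by [sat_plug]. *)
Lemma langN_least G L :
  (forall A alpha u, List.In (A, alpha) (rules G) -> sat L alpha u -> L A u) ->
  forall A u, langN G A u -> L A u.
Proof.
move=> closed A _ [alpha [der [/(sat_ground L) sat_alpha <-]]].
elim: der (nu alpha) sat_alpha => {alpha} [//|C B beta inr _ IH] u sat_u.
apply: IH; apply: sat_plug sat_u => v; exact: closed inr.
Qed.

Lemma derives_trans G A B C beta :
  derives G A (plug C (NT B)) -> derives G B beta -> derives G A (plug C beta).
Proof.
move=> dA; elim=> [//|D E gamma inr _]; rewrite -!plug_ccomp => dE.
exact: der_step inr dE.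
Qed.

Lemma langN_rule G A alpha u :
  List.In (A, alpha) (rules G) -> sat (langN G) alpha u -> langN G A u.
Proof.
move=> inr.
have: derives G A (plug Hole alpha) by apply: (der_step (C := Hole)) inr (der_refl _ _).
(* Nonterminals are rewritten from left to right; the part that is already ground moves into the
   context. *)
have langN_plug t C v : derives G A (plug C t) -> sat (langN G) t v ->
    exists g, [/\ derives G A (plug C g), ground g & nu g = v].
  rewrite /ground.
  elim: t C v => [w|B|a IHa b IHb|j a IHa b IHb] C v /= der.
  - by move=> ->; exists (Leaf w).
  - by case=> g [dg [gg <-]]; exists g; split=> //; apply: derives_trans dg.
  - case=> [u1 [u2 [s1 s2 ->]]].
    have [|ga [da gga nga]] := IHa (ccomp C (CatL Hole b)) u1 _ s1.
      by rewrite plug_ccomp.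
    have [|gb [db ggb ngb]] := IHb (ccomp C (CatR ga Hole)) u2 _ s2.
      by move: da; rewrite !plug_ccomp.
    exists (Cat ga gb); move: db; rewrite plug_ccomp /= => db.
    by rewrite (eqP gga) (eqP ggb) nga ngb.
  - case=> [u1 [u2 [s1 s2 ->]]].
    have [|ga [da gga nga]] := IHa (ccomp C (IntL j Hole b)) u1 _ s1.
      by rewrite plug_ccomp.
    have [|gb [db ggb ngb]] := IHb (ccomp C (IntR j ga Hole)) u2 _ s2.
      by move: da; rewrite !plug_ccomp.
    exists (Int j ga gb); move: db; rewrite plug_ccomp /= => db.
    by rewrite (eqP gga) (eqP ggb) nga ngb.
by move=> d /(langN_plug _ _ _ d)[g [dg gg ng]]; exists g.
Qed.

End Semantics.

(** * Tuples as words with separators, and replacement of separators *)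

Section Words.
Variable T : Type.
Implicit Types (w v p q : seq (option T)) (u x y : tuple_ T).

Definition nsep w := count (fun c => ~~ isSome c) w.
Definition nlet w := count (@isSome T) w.

Lemma nsep_cat p q : nsep (p ++ q) = nsep p + nsep q.
Proof. exact: count_cat. Qed.

Definition enc u : seq (option T) :=
  map Some u.1 ++ flatten [seq None :: map Some s | s <- u.2].

Fixpoint dec w : tuple_ T :=
  match w with
  | [::] => teps
  | Some a :: w' => (a :: (dec w').1, (dec w').2)
  | None :: w' => ([::], tseq (dec w'))
  end.

Lemma decK : cancel dec enc.
Proof.
by rewrite /enc; elim=> [//|[a|] w /=]; [move=> -> | move=> IH; rewrite IH].
Qed.

Lemma encK : cancel enc dec.
Proof.
have dec_letters (s : seq T) w :
    dec (map Some s ++ w) = (s ++ (dec w).1, (dec w).2).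
  by elim: s => [|a s IH] /=; [case: (dec w) | rewrite IH].
case=> s l; rewrite /enc dec_letters /=.
suff ->: dec (flatten [seq None :: map Some s0 | s0 <- l]) = ([::], l).
  by rewrite cats0.
by elim: l => [//|s' l IH] /=; rewrite dec_letters IH /= cats0.
Qed.

Lemma enc_tcat x y : enc (tcat x y) = enc x ++ enc y.
Proof.
have enc_cons (s : seq T) l : l <> [::] -> enc (s, l) = map Some s ++ None :: enc (tofseq l).
  by case: l.
case: x => s l; rewrite /tcat /=.
elim: l s => [|t l IH] s /=; first by rewrite /enc /= map_cat cats0 catA.
rewrite [LHS]enc_cons; last by case: (belast t l).
by rewrite IH (enc_cons s (t :: l)) // -catA.
Qed.

Lemma nsep_letters (s : seq T) : nsep (map Some s) = 0.
Proof. by rewrite /nsep count_map; elim: s. Qed.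

Lemma nsep_enc u : nsep (enc u) = trank u.
Proof.
case: u => s l; rewrite /enc nsep_cat nsep_letters /trank /=.
by elim: l => //= t l IH; rewrite nsep_cat nsep_letters IH.
Qed.

Lemma trank_dec w : trank (dec w) = nsep w.
Proof. by rewrite -nsep_enc decK. Qed.

(** Intercalation becomes replacement of one separator. It counts positions from 1, while [j] counts
    the separators to the left, hence [j.+1]. *)
Lemma enc_tint j x y p q :
  enc x = p ++ None :: q -> nsep p = j -> enc (tint j.+1 x y) = p ++ enc y ++ q.
Proof.
move=> ex np; rewrite -(encK x) ex /tint.
have tseq_dec v v' : tseq (dec (v ++ None :: v')) = tseq (dec v) ++ tseq (dec v').
  by elim: v => //= [[a|] v IH] //=; rewrite -?IH; case: (dec (v ++ _)) IH => ? ? [-> ->].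
have sz v : size (tseq (dec v)) = (nsep v).+1 by rewrite -trank_dec.
have tofseqK (v : tuple_ T) : tofseq (tseq v) = v by case: v.
rewrite tseq_dec take_size_cat ?sz ?np // drop_size_cat ?sz ?np //.
by rewrite !tofseqK !enc_tcat !decK catA.
Qed.

Lemma sep_split w j : j < nsep w -> exists p q, w = p ++ None :: q /\ nsep p = j.
Proof.
elim: w j => [//|[a|] w IH] j /= lt_j.
- by have [|p [q [-> np]]] := IH j; [|exists (Some a :: p), q].
- case: j lt_j => [|j] lt_j; first by exists [::], w.
  by have [|p [q [-> np]]] := IH j; [|exists (None :: p), q; rewrite /= np].
Qed.

Fixpoint rep j v w : seq (option T) :=
  match w with
  | [::] => [::]
  | Some a :: w' => Some a :: rep j v w'
  | None :: w' => if j is j'.+1 then None :: rep j' v w' else v ++ w'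
  end.

Lemma rep_cat p q v : rep (nsep p) v (p ++ None :: q) = p ++ v ++ q.
Proof. by elim: p => [|[a|] p IH] //=; rewrite -[nsep _]/(nsep p) IH. Qed.

(** The head of the list is applied last, so the tail of the list describes the preceding stage. *)
Definition run (ops : seq (nat * seq (option T))) w :=
  foldr (fun o => rep o.1 o.2) w ops.

(* The outer separators make prepending and appending special cases of
   replacing a separator. *)
Definition ext w := None :: rcons w None.

Definition starts_sep w := if w is None :: _ then true else false.
Definition ends_sep w := starts_sep (rev w).

Lemma starts_sep_cat p q :
  starts_sep (p ++ q) = if nilp p then starts_sep q else starts_sep p.
Proof. by case: p. Qed.

Lemma ends_sep_cat p q :
  ends_sep (p ++ q) = if nilp q then ends_sep p else ends_sep q.
Proof. by rewrite /ends_sep rev_cat starts_sep_cat /nilp size_rev. Qed.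

(** The bound [k.+2] makes room for the two outer separators of [ext]. *)
Definition good k w := [&& starts_sep w, ends_sep w & nsep w <= k.+2].

Lemma nsep_ext w : nsep (ext w) = (nsep w).+2.
Proof. by rewrite /ext -cats1 -cat1s !nsep_cat /= addn1. Qed.

Lemma good_ext k w : good k (ext w) = (nsep w <= k).
Proof.
by rewrite /good nsep_ext !ltnS /= /ends_sep /ext rev_cons rev_rcons.
Qed.

Fixpoint okrun k (ops : seq (nat * seq (option T))) w : Prop :=
  good k (run ops w) /\
  match ops with
  | [::] => True
  | o :: ops' => [/\ o.1 < nsep (run ops' w), nlet o.2 <= 1 & okrun k ops' w]
  end.

Lemma run_cat ops1 ops2 w : run (ops2 ++ ops1) w = run ops2 (run ops1 w).
Proof. exact: foldr_cat. Qed.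

Lemma okrun_cat k ops1 ops2 w :
  okrun k ops1 w -> okrun k ops2 (run ops1 w) -> okrun k (ops2 ++ ops1) w.
Proof.
move=> ok1; elim: ops2 => [//|o ops2 IH] /= [g [lt le /IH ok2]].
by rewrite -!/(run _ _) run_cat.
Qed.

(** Here [v] is an intermediate stage on the way from one separator to [w]. The rank bound follows
    from those at the two ends; the conditions on the ends of [v] matter when [p] or [q] is
    empty. *)
Lemma good_between k p q v w : good k (p ++ None :: q) -> good k (p ++ w ++ q) ->
  0 < size v -> 0 < size w -> (starts_sep w -> starts_sep v) ->
  (ends_sep w -> ends_sep v) -> nsep v <= maxn 1 (nsep w) -> good k (p ++ v ++ q).
Proof.
rewrite /good -[None :: q]cat1s !starts_sep_cat !ends_sep_cat !nsep_cat.
move=> /and3P[s e le] /and3P[s' e' le'] v0 w0 sv ev lv.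
have nil (x y : seq (option T)) : 0 < size x -> nilp (x ++ y) = false by case: x.
move: s s' e e'; rewrite (nil w) // (nil v) // -(cats0 w) -(cats0 v) !nil // !cats0.
move=> s s' e e'; apply/and3P; split.
- by case: (nilp p) s s' => // _ /sv.
- by case: (nilp q) e e' => // _ /ev.
- move: lv le le'; rewrite /= -!/(nsep _); lia.
Qed.

(** Symbols of [w] are split off one at a time, the rest being represented by a separator still to
    be replaced, until at most one letter is left. The operations are fixed before [p] and [q], so
    one list serves all words. *)
Lemma replace_ops k w j : exists ops, forall p q, nsep p = j ->
  good k (p ++ None :: q) -> good k (p ++ w ++ q) ->
  run ops (p ++ None :: q) = p ++ w ++ q /\ okrun k ops (p ++ None :: q).
Proof.
have one v i p q : nlet v <= 1 -> nsep p = i ->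
    good k (p ++ None :: q) -> good k (p ++ v ++ q) ->
    run [:: (i, v)] (p ++ None :: q) = p ++ v ++ q
    /\ okrun k [:: (i, v)] (p ++ None :: q).
  move=> lv <- g1 g2; rewrite /= rep_cat; split=> //; split=> //.
  by split=> //; rewrite nsep_cat /=; lia.
have [n] := ubnP (size w); elim: n w j => // n IH w j lt_w.
have [lw|lw] := leqP (nlet w) 1; first by exists [:: (j, w)] => p q; apply: one.
have step w' p' q' : nlet (p' ++ None :: q') <= 1 -> size w' < n ->
   w = p' ++ w' ++ q' ->
   (starts_sep w -> starts_sep (p' ++ None :: q')) ->
   (ends_sep w -> ends_sep (p' ++ None :: q')) ->
   nsep (p' ++ None :: q') <= maxn 1 (nsep w) ->
   exists ops, forall p q, nsep p = j ->
     good k (p ++ None :: q) -> good k (p ++ w ++ q) ->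
     run ops (p ++ None :: q) = p ++ w ++ q /\ okrun k ops (p ++ None :: q).
  move=> lv lt_w' ew sv ev nv.
  have [ops Hops] := IH w' (j + nsep p') lt_w'.
  exists (ops ++ [:: (j, p' ++ None :: q')]) => p q np g1 g2.
  have g3 : good k (p ++ (p' ++ None :: q') ++ q).
    apply: good_between g1 g2 _ _ sv ev nv; first by rewrite size_cat addnS.
    by case: (w) lw.
  have [r1 o1] := one _ _ p q lv np g1 g3; move: g3; rewrite -catA /= => g3.
  have [|||r2 o2] := Hops (p ++ p') (q' ++ q); rewrite ?nsep_cat ?np -?catA //.
    by rewrite ew -!catA in g2.
  rewrite run_cat r1; split; first by rewrite ew -!catA in r2 *.
  by apply: okrun_cat o1 _; rewrite r1 -!catA in o2 *.
case: w lt_w lw step => [//|[a|] w] lt_w lw step.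
- apply: (step w [:: Some a] [::]); rewrite ?cats0 //; exact: leq_maxl.
(* A leading separator is split off only if another one follows, since the intermediate word then
   has two separators. Otherwise the last symbol, a letter, is split off. *)
case: (posnP (nsep w)) => [w0|wsep]; last first.
- apply: (step w [:: None] [::]); rewrite ?cats0 //.
  by rewrite leq_max; apply/orP; right; exact: wsep.
case: (lastP w) lt_w lw w0 step => [//|{}w [a|]]; rewrite -cats1 nsep_cat /=; last by lia.
rewrite size_cat /= => lt_w lw w0 step.
apply: (step (None :: w) [::] [:: Some a]); rewrite ?leq_maxl //=; first lia.
by rewrite /ends_sep -cat_cons rev_cat.
Qed.
End Words.

(** * Linear terms as sequences of separator replacements *)

Section Compilation.
Variables (Sigma N : Type) (rkN : N -> nat) (k : nat).
Implicit Types (L : N -> tuple_ Sigma -> Prop) (t : term Sigma N).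

Lemma correct_rank t : correct rkN k t -> trk rkN t <= k.
Proof.
elim: t => [v|A|a _ b _|j a _ b _] //=; first by case/and3P.
by case/and5P=> _ _ _ _; lia.
Qed.

Definition ranked L := forall A u, L A u -> trank u = rkN A.

Lemma sat_rank L t u : ranked L -> correct rkN k t -> sat L t u -> trank u = trk rkN t.
Proof.
move=> rL; elim: t u => [v|A|a IHa b IHb|j a IHa b IHb] u /=.
- by move=> _ ->.
- by move=> _; apply: rL.
- case/and3P=> ca cb _ [u1 [u2 [/(IHa _ ca) <- /(IHb _ cb) <- ->]]].
  by rewrite -!nsep_enc enc_tcat nsep_cat.
- case/and5P=> ca cb /andP[j0 _] ja _ [u1 [u2 [/(IHa _ ca) r1 /(IHb _ cb) <- ->]]].
  case: j j0 ja => // j _; rewrite -r1 -[trank u1]nsep_enc => /sep_split[p [q [e np]]].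
  by rewrite -!nsep_enc (enc_tint _ e np) e !nsep_cat /= -!/(nsep _); lia.
Qed.

Lemma rank_nu t : correct rkN k t -> ground t -> trank (nu t) = trk rkN t.
Proof. by move=> ct /(sat_ground (fun _ _ => False)); apply: sat_rank. Qed.

Definition seed L (b : option N) (w : seq (option Sigma)) : Prop :=
  if b is Some B then exists2 u, L B u & w = enc u else w = [::].

(** Quantifying over [L] allows the same operations to be used both for [langN G] and for the
    strengthened predicate of the completeness induction. *)
Definition compiles t (b : option N) ops :=
  forall L, ranked L ->
  (forall w, seed L b w -> okrun k ops (ext w) /\
     exists2 u, sat L t u & run ops (ext w) = ext (enc u)) /\
  (forall u, sat L t u -> exists2 w, seed L b w & run ops (ext w) = ext (enc u)).

Lemma compiles_step t t' b ops ops' (f : tuple_ Sigma -> tuple_ Sigma) :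
  correct rkN k t -> compiles t b ops ->
  (forall u, trank u = trk rkN t ->
     run ops' (ext (enc u)) = ext (enc (f u)) /\ okrun k ops' (ext (enc u))) ->
  (forall L u, sat L t u -> sat L t' (f u)) ->
  (forall L u, sat L t' u -> exists2 u', sat L t u' & u = f u') ->
  compiles t' b (ops' ++ ops).
Proof.
move=> ct comp Hops' t_t' t'_t L rL; have [fwd bwd] := comp L rL; split.
- move=> w /fwd[ok [u su ru]]; have [r' ok'] := Hops' u (sat_rank rL ct su).
  rewrite run_cat ru; split; last by exists (f u); first exact: t_t'.
  by apply: okrun_cat; rewrite ?ru.
- move=> _ /t'_t[u su ->]; have [w sw rw] := bwd u su; exists w => //.
  by rewrite run_cat rw; case: (Hops' u (sat_rank rL ct su)).
Qed.

(** The outer separators are replaced by [None :: v1] and [rcons v2 None], so that they survive. *)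
Lemma surround_ops r (v1 v2 : seq (option Sigma)) : r + nsep v1 + nsep v2 <= k ->
  exists ops, forall w, nsep w = r ->
    run ops (ext w) = ext (v1 ++ w ++ v2) /\ okrun k ops (ext w).
Proof.
move=> le_k.
have [ops1 H1] := replace_ops k (None :: v1) 0.
(* By now the closing separator is preceded by the opening one and [r + nsep v1] others. *)
have [ops2 H2] := replace_ops k (rcons v2 None) (r + nsep v1).+1.
exists (ops2 ++ ops1) => w nw.
have [||r1 o1] := H1 [::] (rcons w None) erefl.
- by rewrite -[good _ _]/(good k (ext w)) good_ext nw; lia.
- rewrite -[[::] ++ _]/(None :: v1 ++ rcons w None) -rcons_cat.
  by rewrite -[good _ _]/(good k (ext (v1 ++ w))) good_ext nsep_cat nw; lia.
have e1 : [::] ++ (None :: v1) ++ rcons w None = (None :: v1 ++ w) ++ [:: None].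
  by rewrite /= -cats1 catA.
have [|||r2 o2] := H2 (None :: v1 ++ w) [::].
- by rewrite /= -/(nsep _) nsep_cat nw; lia.
- rewrite cat_cons cats1 -[good _ _]/(good k (ext (v1 ++ w))) good_ext nsep_cat nw; lia.
- rewrite cats0 cat_cons -rcons_cat -[good _ _]/(good k (ext ((v1 ++ w) ++ v2))).
  by rewrite good_ext !nsep_cat nw; lia.
rewrite run_cat; split; first by rewrite r1 e1 r2 cats0 /ext -!rcons_cat catA.
by apply: okrun_cat o1 _; rewrite r1 e1.
Qed.

(** At a binary node at least one argument is ground and acts as a constant. Concatenation, or
    intercalation into a ground term, surrounds the other argument; intercalation of a ground term
    replaces an inner separator. *)
Lemma compile_linear t : correct rkN k t -> nocc t <= 1 ->
  exists b ops, compiles t b ops.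
Proof.
elim: t => [v|A|a IHa b IHb|j a IHa b IHb] /=.
- move=> rv _; have [|ops H] := @surround_ops 0 (enc v) [::].
    by rewrite nsep_enc addn0.
  exists None, ops => L rL; have [r1 o1] := H [::] erefl.
  rewrite !cats0 in r1; split; first by move=> _ ->; split=> //; exists v.
  by move=> _ ->; exists [::].
- move=> rA _; exists (Some A), [::] => L rL; split; last first.
    by move=> u Lu; exists (enc u); first exists u.
  move=> _ [u Lu ->]; split; last by exists u.
  by rewrite /= good_ext nsep_enc (rL _ _ Lu).
- case/and3P=> ca cb le_k le1.
  have [b0|b1] := posnP (nocc b).
  + have gb : ground b by apply/eqP.
    have [|c [ops comp]] := IHa ca; first lia.
    have [|ops' H] := @surround_ops (trk rkN a) [::] (enc (nu b)).
      by rewrite nsep_enc rank_nu // addn0.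
    exists c, (ops' ++ ops); apply: (compiles_step (f := fun u => tcat u (nu b)) ca comp).
    * by move=> u ru; rewrite enc_tcat; apply: H; rewrite nsep_enc.
    * by move=> L u su; exists u, (nu b); split=> //; apply: sat_ground.
    * by move=> L u [u1 [u2 [s1 /(sat_groundE gb)-> ->]]]; exists u1.
  + have ga : ground a by apply/eqP; lia.
    have [|c [ops comp]] := IHb cb; first lia.
    have [|ops' H] := @surround_ops (trk rkN b) (enc (nu a)) [::].
      by rewrite nsep_enc rank_nu // addn0 addnC.
    exists c, (ops' ++ ops); apply: (compiles_step (f := tcat (nu a)) cb comp).
    * move=> u ru; rewrite enc_tcat -[enc u in X in _ = X]cats0.
      by apply: H; rewrite nsep_enc.
    * by move=> L u su; exists (nu a), u; split=> //; apply: sat_ground.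
    * by move=> L u [u1 [u2 [/(sat_groundE ga)-> s2 ->]]]; exists u2.
- case/and5P=> ca cb /andP[j0 jk] ja le_k le1.
  case: j j0 jk ja => // j _ jk ja.
  have [b0|b1] := posnP (nocc b).
  + have gb : ground b by apply/eqP.
    have [|c [ops comp]] := IHa ca; first lia.
    (* The opening separator of [ext] shifts the position by one. *)
    have [ops' H] := replace_ops k (enc (nu b)) j.+1.
    exists c, (ops' ++ ops); apply: (compiles_step (f := fun u => tint j.+1 u (nu b)) ca comp).
    * move=> u ru; have [|p [q [eu np]]] := @sep_split _ (enc u) j; first by rewrite nsep_enc ru.
      have nu_u := nsep_enc u; rewrite (enc_tint _ eu np) eu.
      rewrite eu nsep_cat /= -/(nsep q) in nu_u.
      have [|||r1 o1] := H (None :: p) (rcons q None).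
      - by rewrite -np.
      - rewrite -[good _ _]/(good k (None :: p ++ rcons (None :: q) None)) -rcons_cat.
        rewrite -[good _ _]/(good k (ext (p ++ None :: q))) good_ext nsep_cat /= -/(nsep q).
        by have := correct_rank ca; lia.
      - rewrite cat_cons -!rcons_cat -[good _ _]/(good k (ext (p ++ enc (nu b) ++ q))).
        by rewrite good_ext (nsep_cat p) (nsep_cat (enc _)) nsep_enc rank_nu //; lia.
      by rewrite /ext !rcons_cat.
    * by move=> L u su; exists u, (nu b); split=> //; apply: sat_ground.
    * by move=> L u [u1 [u2 [s1 /(sat_groundE gb)-> ->]]]; exists u1.
  + have ga : ground a by apply/eqP; lia.
    have [|c [ops comp]] := IHb cb; first lia.
    have [|p [q [ea np]]] := @sep_split _ (enc (nu a)) j; first by rewrite nsep_enc rank_nu.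
    have na := nsep_enc (nu a); rewrite rank_nu // ea nsep_cat /= -/(nsep q) in na.
    have [|ops' H] := @surround_ops (trk rkN b) p q; first lia.
    exists c, (ops' ++ ops); apply: (compiles_step (f := tint j.+1 (nu a)) cb comp).
    * by move=> u ru; rewrite (enc_tint _ ea np); apply: H; rewrite nsep_enc.
    * by move=> L u su; exists (nu a), u; split=> //; apply: sat_ground.
    * by move=> L u [u1 [u2 [/(sat_groundE ga)-> s2 ->]]]; exists u2.
Qed.

End Compilation.

(** * Active and dead separators, and normalization *)

Section MarkedWords.
Variable T : Type.
Implicit Types (z p q s : seq (T + bool)) (c : T + bool) (d b : bool).

(* [inl a] is a letter and [inr b] a separator, active when [b] is true. *)
Definition isl c := if c is inl _ then true else false.
Definition letters z := has isl z.
Definition unmark z : seq (option T) := [seq if c is inl a then Some a else None | c <- z].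

(** The flag [d] records an active separator read since the last letter. It is paid out only when
    the next letter arrives, so that trailing separators vanish. *)
Fixpoint norm_from d z : seq (option T) :=
  match z with
  | [::] => [::]
  | inl a :: z' => nseq d None ++ Some a :: norm_from false z'
  | inr b :: z' => norm_from (d || b) z'
  end.

Fixpoint norm z : seq (option T) :=
  match z with
  | [::] => [::]
  | inl a :: z' => Some a :: norm_from false z'
  | inr _ :: z' => norm z'
  end.

Fixpoint lead z := if z is inr b :: z' then b || lead z' else false.
Definition trail d z := foldl (fun d c => if c is inr b then d || b else false) d z.

Lemma letters_cat p q : letters (p ++ q) = letters p || letters q.
Proof. exact: has_cat. Qed.

Lemma unmark_cat p q : unmark (p ++ q) = unmark p ++ unmark q.
Proof. exact: map_cat. Qed.

Lemma nsep_nseq b : nsep (nseq b None : seq (option T)) = b.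
Proof. by case: b. Qed.

Lemma norm_from_cat d p q :
  norm_from d (p ++ q) = norm_from d p ++ norm_from (trail d p) q.
Proof. by elim: p d => [//|[a|b] p IH] d /=; rewrite IH -?catA. Qed.

Lemma norm_from_letters d z :
  letters z -> norm_from d z = nseq (d || lead z) None ++ norm z.
Proof.
by elim: z d => [//|[a|b] z IH] d /=; [rewrite orbF | move=> /IH->; rewrite orbA].
Qed.

Lemma norm_from_nil d z : ~~ letters z -> norm_from d z = [::].
Proof. by elim: z d => [//|[a|b] z IH] d //= /IH. Qed.

Lemma trail_letters d d' z : letters z -> trail d z = trail d' z.
Proof. by elim: z d d' => [//|[a|b] z IH] d d' //=; apply: IH. Qed.

Lemma trail_lead d s : ~~ letters s -> trail d s = d || lead s.
Proof. by elim: s d => [|[a|b] s IH] d //=; rewrite ?orbF // => /IH->; rewrite orbA. Qed.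

Lemma lead_cat s q : ~~ letters s -> lead (s ++ q) = lead s || lead q.
Proof. by elim: s => [|[a|b] s IH] //= /IH->; rewrite orbA. Qed.

Lemma norm_catl p q : letters p -> norm (p ++ q) = norm p ++ norm_from (trail false p) q.
Proof.
elim: p => [//|[a|b] p IH] /=; first by rewrite norm_from_cat.
by move=> lp; rewrite IH // (trail_letters b false).
Qed.

Lemma norm_catr p q : ~~ letters p -> norm (p ++ q) = norm q.
Proof. by elim: p => [//|[a|b] p IH]. Qed.

Lemma norm_nil z : ~~ letters z -> norm z = [::].
Proof. by elim: z => [//|[a|b] z IH]. Qed.

(** Normalization sees a block of separators only through the disjunction of its marks; an empty
    block amounts to a dead separator. This turns letterless replacements into identities. *)
Lemma norm_block p s q : ~~ letters s ->
  norm (p ++ s ++ q) = norm (p ++ inr (lead s) :: q).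
Proof.
move=> ns; case: (boolP (letters p)) => lp; last by rewrite !norm_catr //.
by rewrite !norm_catl // norm_from_cat norm_from_nil //= trail_lead.
Qed.

Lemma norm_sep p q : letters p -> letters q ->
  norm (p ++ inr true :: q) = norm p ++ None :: norm q.
Proof. by move=> lp lq; rewrite norm_catl //= orbT norm_from_letters. Qed.

Lemma norm_ends b1 b2 z : norm (inr b1 :: rcons z (inr b2)) = norm z.
Proof.
rewrite /= -cats1; case: (boolP (letters z)) => lz; first by rewrite norm_catl // cats0.
by rewrite norm_catr // [RHS]norm_nil.
Qed.

(** Each separator put out is paid for by one that was read or by the pending flag. *)
Lemma nsep_norm_from d z : nsep (norm_from d z) <= d + nsep (unmark z).
Proof.
elim: z d => [//|[a|b] z IH] d /=.
  rewrite nsep_cat nsep_nseq /= leq_add2l; exact: (IH false).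
apply: leq_trans (IH _) _; rewrite -/(nsep _); case: d b => [] []; rewrite /=; lia.
Qed.

Lemma nsep_norm z : nsep (norm z) <= nsep (unmark z).
Proof.
elim: z => [//|[a|b] z IH] /=; first exact: (nsep_norm_from false).
by apply: leq_trans IH _; apply: leqW.
Qed.

Lemma norm_rank0 z : nsep (unmark z) = 0 -> norm z = unmark z.
Proof.
have from z' : nsep (unmark z') = 0 -> norm_from false z' = unmark z'.
  by elim: z' => [//|[a|b] z' IH] //= /IH ->.
by elim: z => [//|[a|b] z IH] //= /from ->.
Qed.

Lemma unmark_split z v w : unmark z = v ++ w ->
  exists p q, [/\ z = p ++ q, unmark p = v & unmark q = w].
Proof.
move=> e; exists (take (size v) z), (drop (size v) z).
by rewrite cat_take_drop /unmark map_take map_drop -/(unmark z) e take_size_cat ?drop_size_cat.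
Qed.

Lemma nlet_unmark z : nlet (unmark z) = count isl z.
Proof. by rewrite /nlet count_map; apply: eq_count => -[]. Qed.

Lemma letters_split z : letters z ->
  exists s a q, z = s ++ inl a :: q /\ ~~ letters s.
Proof.
elim: z => [//|[a|b] z IH] /=; first by exists [::], a, z.
by move=> /IH[s [a [q [-> ns]]]]; exists (inr b :: s), a, q.
Qed.

End MarkedWords.

(** * Patterns: contraction of blocks of letters *)

Section Patterns.
Variable T : Type.
Implicit Types (z p q s : seq (T + bool)) (c : T + bool) (d b : bool).
Implicit Types (r : seq (unit + bool)).

Definition pcons {A} (c : A + bool) r :=
  match c with
  | inr b => inr b :: r
  | inl _ => if r is inl _ :: _ then r else inl tt :: r
  end.

Definition pat {A} (z : seq (A + bool)) := foldr pcons [::] z.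

Lemma pat_cat p q : pat (p ++ q) = foldr pcons (pat q) (pat p).
Proof.
elim: p => [//|[a|b] p IH] /=; last by rewrite -/pat IH.
rewrite -/(pat _) IH -/(pat _); case: (pat p) => [|[[]|b] r] //=.
by case: (foldr _ _ r) => [|[[]|b] r'].
Qed.

Lemma pat_sep p q b : pat (p ++ inr b :: q) = pat p ++ inr b :: pat q.
Proof.
elim: p => [//|[a|b'] p IH] /=; rewrite -!/(pat _) IH //.
by case: (pat p) => [|[[]|b''] r].
Qed.

Lemma letters_pat z : letters (pat z) = letters z.
Proof. by elim: z => [//|[a|b] z IH] //=; rewrite -/(pat _); case: (pat z) => [|[[]|b] r]. Qed.

Lemma lead_pat z : lead (pat z) = lead z.
Proof.
by elim: z => [//|[a|b] z IH] /=; rewrite -/(pat _) ?IH //; case: (pat z) => [|[[]|b] r].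
Qed.

Lemma trail_pat d z : trail d (pat z) = trail d z.
Proof.
elim: z d => [//|[a|b] z IH] d /=; rewrite -/(pat _) -/(trail _ _) //.
by rewrite -IH; case: (pat z) => [|[[]|b] r].
Qed.

Lemma nsep_pat z : nsep (unmark (pat z)) = nsep (unmark z).
Proof.
elim: z => [//|[a|b] z IH] /=; rewrite -/(pat _) -!/(nsep _) -?IH //.
by case: (pat z) => [|[[]|b] r].
Qed.

Lemma nsep_norm_from_pat d z : nsep (norm_from d (pat z)) = nsep (norm_from d z).
Proof.
elim: z d => [//|[a|b] z IH] d /=; rewrite -/(pat _) //.
rewrite nsep_cat /= -/(nsep _) -IH.
by rewrite nsep_nseq; case: (pat z) => [|[[]|b] r] /=; rewrite nsep_cat nsep_nseq.
Qed.

Lemma nsep_norm_pat z : nsep (norm (pat z)) = nsep (norm z).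
Proof.
elim: z => [//|[a|b] z IH] /=; rewrite -/(pat _) // -[RHS]/(nsep (norm_from _ _)).
by rewrite -nsep_norm_from_pat; case: (pat z) => [|[[]|b] r].
Qed.

(** Separators are never contracted, so a cut of the pattern at a separator lifts to every word with
    that pattern. *)
Lemma pat_split z r1 b r2 : pat z = r1 ++ inr b :: r2 ->
  exists p q, [/\ z = p ++ inr b :: q, pat p = r1 & pat q = r2].
Proof.
elim: z r1 => [|[a|b'] z IH] r1 /=; first by case: r1.
- rewrite -/(pat _); case ez: (pat z) => [|[[]|b''] r] => e.
  + by case: r1 e => [|? []].
  + have [p [q [-> ep eq]]] := IH r1 (etrans ez e); exists (inl a :: p), q.
    split=> //=; rewrite -/(pat _) ep.
    by case: r1 e {ep} => [|[[]|?] r1].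
  + case: r1 e => [//|c r1] [<- e].
    have [p [q [-> ep eq]]] := IH r1 (etrans ez e); exists (inl a :: p), q.
    split=> //=; rewrite -/(pat _) ep.
    by case: r1 e {ep} => [|c' r1] //= [<-].
- rewrite -/(pat _); case: r1 => [[<- <-]|c r1 [<- e]]; first by exists [::], z.
  by have [p [q [-> ep eq]]] := IH r1 e; exists (inr b' :: p), q; rewrite /= -/(pat _) ep.
Qed.

(** Two contracted blocks are never adjacent; the induction saves one when the pattern does not
    start with a letter. *)
Lemma size_pat z : size (pat z) <= (nsep (unmark z)).*2.+1.
Proof.
have: size (pat z) <= (nsep (unmark z)).*2 + (if pat z is inl _ :: _ then 1 else 0).
  elim: z => [//|[a|b] z] /=; rewrite -/(pat _) -/(nsep _).
    by case: (pat z) => [|[[]|b] r] //=; rewrite -!/(nsep _); lia.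
  by case: (pat z) => [|[[]|b'] r] //=; lia.
by case: (pat z) => [|[[]|b] r] //=; lia.
Qed.

End Patterns.

(** * Insertion of one letter as a normal-form term *)

Section Insertion.
Variables (Sigma M : Type).
Implicit Types (P Q : seq (Sigma + bool)) (B : M) (a : Sigma).
Implicit Types (L : M -> tuple_ Sigma -> Prop).

(** The flags [hp] and [hq] tell whether letters lie to the left and to the right of [a], and [t]
    and [h] whether an active separator stays in between. With letters on one side only, the
    replaced separator is an outer one, which [norm] erases, so the insertion is a concatenation. *)
Definition ins_term hp hq (t h : bool) j a B : term Sigma M :=
  if hp then
    if hq then Int j.+1 (NT B) (Leaf (dec (nseq t None ++ Some a :: nseq h None)))
    else Cat (NT B) (Leaf (dec (nseq t None ++ [:: Some a])))
  else if hq then Cat (Leaf (dec (Some a :: nseq h None))) (NT B)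
  else Leaf (dec [:: Some a]).

Definition ins_at P Q a B :=
  ins_term (letters P) (letters Q) (trail false P) (lead Q) (nsep (norm P)) a B.

Lemma norm_insert P Q a : norm (P ++ inl a :: Q) =
  (if letters P then norm P ++ nseq (trail false P) None else [::]) ++
  Some a :: (if letters Q then nseq (lead Q) None ++ norm Q else [::]).
Proof.
have tail : norm_from false Q = if letters Q then nseq (lead Q) None ++ norm Q else [::].
  case: (boolP (letters Q)) => lQ; [exact: norm_from_letters|exact: norm_from_nil].
case: (boolP (letters P)) => lP; last by rewrite norm_catr //= tail.
by rewrite norm_catl //= tail -catA.
Qed.

Lemma sat_ins_atI L P Q a B u :
  (letters (P ++ Q) -> exists2 y, L B y & enc y = norm (P ++ inr true :: Q)) ->
  enc u = norm (P ++ inl a :: Q) -> sat L (ins_at P Q a B) u.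
Proof.
rewrite letters_cat norm_insert /ins_at /ins_term.
case: (boolP (letters P)) => lP; case: (boolP (letters Q)) => lQ /= hy eu.
- have [//|y Ly ey] := hy; rewrite norm_sep // in ey.
  exists y, (dec (nseq (trail false P) None ++ Some a :: nseq (lead Q) None)).
  split=> //; apply: (can_inj (@encK _)); rewrite (enc_tint _ ey erefl) decK eu.
  by rewrite /= -!catA.
- have [//|y Ly ey] := hy; rewrite -cat1s catA norm_catl ?letters_cat ?lP //= in ey.
  rewrite norm_from_nil // cats0 norm_catl //= cats0 in ey.
  exists y, (dec (nseq (trail false P) None ++ [:: Some a])).
  by split=> //; apply: (can_inj (@encK _)); rewrite enc_tcat decK eu ey -catA.
- have [//|y Ly ey] := hy; rewrite norm_catr //= in ey.
  exists (dec (Some a :: nseq (lead Q) None)), y.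
  by split=> //; apply: (can_inj (@encK _)); rewrite enc_tcat decK eu ey.
- by rewrite -[u]encK eu.
Qed.

(** The shape of the term depends only on the patterns of [P] and [Q], so it fits any [P'] and [Q']
    with these patterns. The relation [R] carries along the run they come from; if the term is a
    leaf, [P] and [Q] themselves are the witnesses. *)
Lemma sat_ins_atE L P Q a B u (R : seq (Sigma + bool) -> seq (Sigma + bool) -> Prop) :
  (forall y, L B y -> exists P' Q',
     [/\ pat P' = pat P, pat Q' = pat Q, R P' Q' & enc y = norm (P' ++ inr true :: Q')]) ->
  R P Q -> sat L (ins_at P Q a B) u ->
  exists P' Q', [/\ pat P' = pat P, pat Q' = pat Q, R P' Q' & enc u = norm (P' ++ inl a :: Q')].
Proof.
move=> hy RPQ; rewrite /ins_at /ins_term.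
case: (boolP (letters P)) => lP; case: (boolP (letters Q)) => lQ /=.
- move=> [y [_ [/hy[P' [Q' [pP pQ R' ey]]] -> ->]]]; exists P', Q'; split=> //.
  have lP' : letters P' by rewrite -letters_pat pP letters_pat.
  have lQ' : letters Q' by rewrite -letters_pat pQ letters_pat.
  rewrite norm_sep // in ey.
  rewrite (enc_tint _ ey) ?decK; last by rewrite -nsep_norm_pat pP nsep_norm_pat.
  rewrite norm_insert lP' lQ' -!catA /=.
  by rewrite -(trail_pat _ P') -(lead_pat Q') pP pQ trail_pat lead_pat.
- move=> [y [_ [/hy[P' [Q' [pP pQ R' ey]]] -> ->]]]; exists P', Q'; split=> //.
  have lP' : letters P' by rewrite -letters_pat pP letters_pat.
  have lQ' : ~~ letters Q' by rewrite -letters_pat pQ letters_pat.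
  rewrite norm_catl //= norm_from_nil // cats0 in ey.
  rewrite enc_tcat ey decK norm_insert lP' (negPf lQ') -catA.
  by rewrite -(trail_pat _ P') pP trail_pat.
- move=> [_ [y [-> /hy[P' [Q' [pP pQ R' ey]]] ->]]]; exists P', Q'; split=> //.
  have lP' : ~~ letters P' by rewrite -letters_pat pP letters_pat.
  have lQ' : letters Q' by rewrite -letters_pat pQ letters_pat.
  rewrite norm_catr //= in ey.
  rewrite -[(a :: _, _)]/(dec (Some a :: nseq (lead Q) None)).
  rewrite enc_tcat decK ey norm_insert (negPf lP') lQ'.
  by rewrite -(lead_pat Q') pQ lead_pat.
- by move=> ->; exists P, Q; rewrite norm_insert (negPf lP) (negPf lQ).
Qed.

Lemma ins_at_rank (rkM : M -> nat) k P Q a B :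
  (letters (P ++ Q) -> rkM B = nsep (norm (P ++ inr true :: Q))) ->
  nsep (norm (P ++ inr true :: Q)) <= k -> nsep (norm (P ++ inl a :: Q)) <= k ->
  correct rkM k (ins_at P Q a B) /\
  trk rkM (ins_at P Q a B) = nsep (norm (P ++ inl a :: Q)).
Proof.
rewrite letters_cat norm_insert /ins_at /ins_term.
case: (boolP (letters P)) => lP; case: (boolP (letters Q)) => lQ;
  move=> rB le1; rewrite ?nsep_cat ?nsep_nseq.
- rewrite norm_sep // nsep_cat /= -/(nsep _) in rB le1; have {}rB := rB isT.
  have := trank_dec (nseq (trail false P) None ++ Some a :: nseq (lead Q) None).
  move: (dec _) => v; rewrite nsep_cat /= -?/(nsep _) !nsep_cat !nsep_nseq rB => rv le2.
  by split; [apply/and5P; split|]; lia.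
- rewrite norm_catl //= norm_from_nil // cats0 in rB; have {}rB := rB isT.
  have := trank_dec (nseq (trail false P) None ++ [:: Some a]).
  move: (dec _) => v; rewrite nsep_cat nsep_nseq /= rB => rv le2.
  by split; [apply/and3P; split|]; lia.
- rewrite norm_catr //= in rB; have {}rB := rB isT.
  have := trank_dec (Some a :: nseq (lead Q) None).
  move: (dec _) => v; rewrite /= -!/(nsep _) nsep_cat !nsep_nseq rB => rv le2.
  by split; [apply/and3P; split|]; lia.
- by [].
Qed.

End Insertion.

(** Excluded middle selects the sound rules from the finite list of candidates without a decision
    procedure. *)
Lemma filter_Prop (X : Type) (P : X -> Prop) (s : seq X) :
  exists s', forall x, List.In x s' <-> List.In x s /\ P x.
Proof.
elim: s => [|x s [s' IH]]; first by exists [::] => x; split=> [[]|[]].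
have [Px|nPx] := classic (P x); [exists (x :: s')|exists s'] => y /=; rewrite IH; split.
- by case=> [<-|[? ?]]; tauto.
- by tauto.
- by tauto.
- by case=> [[<-|?] ?]; tauto.
Qed.

Lemma unmark_ext T (z : seq (T + bool)) w : unmark z = ext w ->
  exists b1 b2 z', z = inr b1 :: rcons z' (inr b2) /\ unmark z' = w.
Proof.
case: z => [//|[a|b] z] // [].
case: (lastP z) => [|z' c]; first by case: w.
by rewrite /unmark map_rcons => /rcons_inj[<-]; case: c => // b2 _; exists b, b2, z'.
Qed.

Lemma good_nsep_norm T k (z : seq (T + bool)) : good k (unmark z) -> nsep (norm z) <= k.
Proof.
case: z => [|[a|b] z] // /and3P[_ +]; case: (lastP z) => [//|z' c].
rewrite /ends_sep /unmark /= map_rcons rev_cons rev_rcons; case: c => //= b2 _.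
rewrite -[norm _]/(norm (inr b :: rcons z' (inr b2))) norm_ends -cats1 nsep_cat /=.
by have := nsep_norm z'; rewrite /unmark; lia.
Qed.

Lemma ins_term_normal Sigma M (G : grammar Sigma M) A hp hq t h j a B :
  normal_rule G A (ins_term hp hq t h j a B) /\ leaves_ok (ins_term hp hq t h j a B).
Proof.
have len (t' h' : bool) : tlen (dec (nseq t' None ++ Some a :: nseq h' None)) = 1.
  by case: t' h' => [] [].
have len0 (t' : bool) : tlen (dec (nseq t' None ++ [:: Some a])) = 1 by case: t'.
rewrite /ins_term; case: hp; case: hq.
- by split; [right; left; do 3!eexists; split; last by []|rewrite /= len].
- by split; [left; do 2!eexists; split; last by right|rewrite /= len0].
- by split; [left; do 2!eexists; split; last by left|];
    rewrite -[Some a :: _]cat0s ?/leaves_ok (len false).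
- by split=> //; right; right; left; eexists; split; last by [].
Qed.

(** * The normal-form grammar and its correctness *)

Section NormalForm.
Variables (Sigma N : finType) (G : grammar Sigma N) (k : nat).
Hypotheses (dcfgG : is_DCFG G k) (linG : linear_grammar G).

Local Notation item := (option N * seq (nat * seq (option Sigma)))%type.

Lemma ranked_langN : ranked (rk G) (langN G).
Proof.
apply: langN_least => A alpha u inr su.
have [ca <- _] := dcfgG.2 _ _ inr.
by apply: sat_rank ca su.
Qed.

(** There are finitely many rules, and each compiled list has finitely many suffixes, which are its
    stages. *)
Lemma items_exist : exists items : seq item,
  [/\ forall A, (Some A, [::]) \in items,
      forall b o ops, (b, o :: ops) \in items -> (b, ops) \in items
    & forall A alpha, List.In (A, alpha) (rules G) ->
        exists2 c, c \in items & compiles (rk G) k alpha c.1 c.2].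
Proof.
have [cs Hcs] : exists cs : seq item, forall A alpha, List.In (A, alpha) (rules G) ->
    exists2 c, c \in cs & compiles (rk G) k alpha c.1 c.2.
  have: forall A alpha, List.In (A, alpha) (rules G) ->
      correct (rk G) k alpha /\ nocc alpha <= 1.
    by move=> A alpha inr; have [? _ _] := dcfgG.2 _ _ inr; split=> //; apply: linG inr.
  elim: (rules G) => [|[A alpha] rs IH] Hrs; first by exists [::].
  have [|cs Hcs] := IH; first by move=> B beta inr; apply: (Hrs B); right.
  have [ca la] := Hrs A alpha (or_introl erefl).
  have [b [ops comp]] := compile_linear ca la.
  exists ((b, ops) :: cs) => B beta [[_ <-]|inr]; first by exists (b, ops); rewrite ?mem_head.
  by have [c cin ?] := Hcs B beta inr; exists c; rewrite // in_cons cin orbT.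
pose items := [seq (Some A, [::]) | A <- enum N] ++
  [seq (c.1, drop i c.2) | c <- cs, i <- iota 0 (size c.2).+1].
have tailP (c : item) i : c \in cs -> i <= size c.2 -> (c.1, drop i c.2) \in items.
  move=> cin le_i; rewrite mem_cat; apply/orP; right.
  apply: (allpairs_f_dep (fun (c : item) i => (c.1, drop i c.2))) => //.
  by rewrite mem_iota.
exists items; split.
- by move=> A; rewrite mem_cat map_f ?mem_enum.
- move=> b o ops; rewrite mem_cat => /orP[/mapP[? _ []]//|].
  case/allpairsPdep=> c [i [cin _ [-> e]]].
  have -> : ops = drop i.+1 c.2 by rewrite -add1n -drop_drop -e /= drop0.
  by apply: tailP => //; have := size_drop i c.2; rewrite -e /=; lia.
- move=> A alpha /Hcs[c cin comp]; exists c => //.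
  by have := tailP c 0 cin isT; rewrite drop0; case: (c).
Qed.

Variable items : seq item.
Hypothesis items_NT : forall A, (Some A, [::]) \in items.
Hypothesis items_tail : forall b o ops, (b, o :: ops) \in items -> (b, ops) \in items.
Hypothesis items_rules : forall A alpha, List.In (A, alpha) (rules G) ->
  exists2 c, c \in items & compiles (rk G) k alpha c.1 c.2.

Local Notation state := (item * seq (unit + bool))%type.

Definition states : seq state :=
  [seq (c, r) | c <- items,
    r <- [seq val b | b <- enum {bseq k.+2.*2.+1 of (unit + bool)}]].

(** [None] is the new start symbol. It is also the default of [nt_of] outside [states], a case that
    [nt_of_some] excludes for good words. *)
Definition newNT := option (seq_sub states).
Definition nt_of (s : state) : newNT := insub s.

Definition state_lang (s : state) u := exists w z,
  [/\ seed (langN G) s.1.1 w, unmark z = run s.1.2 (ext w), pat z = s.2 & enc u = norm z].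

Definition nt_lang (A : newNT) u :=
  if A is Some s then state_lang (val s) u else langN G (start G) u.
Definition new_rk (A : newNT) := if A is Some s then nsep (norm (val s).2) else 0.

Lemma nt_of_some c (z : seq (Sigma + bool)) : c \in items -> good k (unmark z) ->
  exists2 s, nt_of (c, pat z) = Some s & val s = (c, pat z).
Proof.
move=> cin gz; have : (c, pat z) \in states.
  apply/allpairsP; exists (c, pat z); split=> //=.
  have sz : size (pat z) <= k.+2.*2.+1.
    apply: leq_trans (size_pat z) _; rewrite ltnS leq_double.
    by case/and3P: gz.
  by apply/mapP; exists (Bseq sz); rewrite ?mem_enum.
by rewrite /nt_of => zin; case: insubP => [s _ ?|]; [exists s|rewrite zin].
Qed.

(** The position [j] counts separators in a part of a normalized word of rank at most [k], so the
    codes form a finite type. The code [None] stands for the rule producing the empty word. *)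
Definition candidate (x : option (bool * bool * bool * bool * 'I_k.+1 * Sigma * newNT)) :
    term Sigma newNT :=
  if x is Some (hp, hq, t, h, j, a, B) then ins_term hp hq t h j a B else Leaf teps.

(** [normal_rule] consults only the start symbol of its grammar, so a grammar without rules can be
    passed before the rules are chosen. *)
Definition sound_rule (r : newNT * term Sigma newNT) :=
  [/\ correct new_rk k r.2, trk new_rk r.2 = new_rk r.1, leaves_ok r.2,
      normal_rule (Grammar new_rk [::] None) r.1 r.2
    & forall u, sat nt_lang r.2 u -> nt_lang r.1 u].

Lemma sound_rules_exist : exists rs, forall A alpha,
  List.In (A, alpha) rs <-> (exists x, alpha = candidate x) /\ sound_rule (A, alpha).
Proof.
have [rs Hrs] := filter_Prop sound_rule [seq (x.1, candidate x.2) | x <- enum predT].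
exists rs => A alpha; rewrite Hrs; split=> [[/List.in_map_iff[x [[_ <-] _]] ?]|[[x ->] ?]].
  by split=> //; exists x.2.
split=> //; apply/List.in_map_iff; exists (A, x); split=> //.
have: (A, x) \in enum predT by rewrite mem_enum.
by elim: (enum _) => //= y s IH; rewrite in_cons => /orP[/eqP->|/IH]; [left|right].
Qed.

Variable rs : seq (newNT * term Sigma newNT).
Hypothesis rsP : forall A alpha,
  List.In (A, alpha) rs <-> (exists x, alpha = candidate x) /\ sound_rule (A, alpha).

Definition newG := Grammar new_rk rs None.

Lemma langN_sound A u : langN newG A u -> nt_lang A u.
Proof. by apply: langN_least => {}A alpha {}u /rsP[_ [_ _ _ _]]; apply. Qed.

(* Soundness of a rule only depends on the languages, so passing to a larger
   language preserves it: this replaces the elimination of unit rules. *)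
Lemma langN_subsume A B u : B <> None -> new_rk A = new_rk B ->
  (forall v, nt_lang B v -> nt_lang A v) -> langN newG B u -> langN newG A u.
Proof.
move=> nB rAB AB lB.
suff: langN newG B u /\ (forall A, B <> None -> new_rk A = new_rk B ->
  (forall v, nt_lang B v -> nt_lang A v) -> langN newG A u) by case=> _; apply.
move: B u lB {nB rAB AB A}; apply: langN_least => B alpha u inr su.
have su' : sat (langN newG) alpha u by apply: sat_mono su => ? ? [].
split; first exact: langN_rule inr su'.
move=> A nB rAB AB; apply: langN_rule su'; apply/rsP.
have [[x ->] [ca ra la na sa]] := (rsP _ _).1 inr; split; first by exists x.
split=> //=; [by rewrite rAB | | by move=> v /sa/AB].
by case: na => [h|[h|[h|[eB _]]]]; [left|right; left|right; right; left|case: nB].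
Qed.

(** Induction on [ops]. The marked word splits along the last replacement as [zp ++ zv ++ zq]. The
    replaced separator is marked by [lead zv] if [zv] has no letter, and as active otherwise. *)
Lemma langN_run b ops w : (b, ops) \in items -> seed (langN G) b w ->
  okrun k ops (ext w) ->
  (forall B, b = Some B -> forall z, unmark z = ext w -> letters z ->
    forall u, enc u = norm z -> langN newG (nt_of ((b, [::]), pat z)) u) ->
  forall z, unmark z = run ops (ext w) -> letters z ->
    forall u, enc u = norm z -> langN newG (nt_of ((b, ops), pat z)) u.
Proof.
move=> + sw + base; elim: ops => [_ _|[j v] ops IH] /=.
  case: b sw base => [B|] sw base; first exact: (base B).
  move=> z ez; suff /negPf-> : ~~ letters z by [].
  by rewrite /letters has_count -nlet_unmark ez sw.
move=> in_items [gz [ltj lv ok]] z ez lz u eu.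
have in_tail := items_tail in_items; have {}IH := IH in_tail ok.
have gw : good k (run ops (ext w)) by case: ops {IH in_items in_tail ez gz ltj} ok => [|? ?] [].
have [p [q [ew np]]] := sep_split ltj.
rewrite /= in gz; rewrite -!/(run _ _) in ez gz.
have: unmark z = p ++ v ++ q by rewrite ez ew -np rep_cat.
case/unmark_split=> zp [zr [ezz ep]].
case/unmark_split=> zv [zq [ezr ev eq]]; rewrite {}ezr {zr} in ezz.
(* Equal patterns have equally many separators, so position [j] is again the cut between [p'] and
   [q']. *)
have runE w' p' q' : unmark p' ++ None :: unmark q' = run ops (ext w') ->
    pat p' = pat zp -> unmark p' ++ v ++ unmark q' = rep j v (run ops (ext w')).
  by move=> <- pp; rewrite -rep_cat -nsep_pat pp nsep_pat ep np.
have gzm : good k (unmark z) by rewrite ez.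
have gz0 m : good k (unmark (zp ++ inr m :: zq)) by rewrite unmark_cat /= -/(unmark _) ep eq -ew.
have [s es vs] := nt_of_some in_items gzm.
have st0 m := nt_of_some in_tail (gz0 m).
have state_langE m y : state_lang ((b, ops), pat (zp ++ inr m :: zq)) y ->
    exists w' p' q', [/\ seed (langN G) b w', unmark p' ++ None :: unmark q' = run ops (ext w'),
      pat p' = pat zp, pat q' = pat zq & enc y = norm (p' ++ inr m :: q')].
  case=> w' [z' [sw' ez' /= pz' ey]]; move: pz'; rewrite pat_sep => /pat_split[p' [q' [ezp pp pq]]].
  by exists w', p', q'; rewrite -ezp; split=> //; rewrite -ez' ezp unmark_cat.
case: (boolP (letters zv)) => lzv; last first.
  have [s0 es0 vs0] := st0 (lead zv).
  have ez0 : norm (zp ++ zv ++ zq) = norm (zp ++ inr (lead zv) :: zq) by apply: norm_block.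
  apply: (@langN_subsume _ (nt_of ((b, ops), pat (zp ++ inr (lead zv) :: zq)))).
  - by rewrite es0.
  - by rewrite es es0 /= vs vs0 /= !nsep_norm_pat ezz ez0.
  - move=> y; rewrite es es0 /= vs vs0 => /state_langE[w' [p' [q' [sw' ew' pp pq ey]]]].
    exists w', (p' ++ zv ++ q'); split=> //=.
    + by rewrite !unmark_cat ev (runE w').
    + by rewrite ezz !pat_cat pp pq.
    + by rewrite norm_block.
  - apply: IH; last by rewrite eu ezz.
      by rewrite unmark_cat /= -/(unmark _) ep eq ew.
    by move: lz; rewrite ezz !letters_cat (negPf lzv).
have [s1 [a [s2 [ezv ns1]]]] := letters_split lzv.
have ns2 : ~~ letters s2.
  move: lv; rewrite -ev nlet_unmark ezv count_cat /= /letters has_count; lia.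
have [s0 es0 vs0] := st0 true.
(* The separators of [zv] on both sides of its letter are absorbed by the active separator. *)
have blk p' q' : norm ((p' ++ s1) ++ inr true :: s2 ++ q') = norm (p' ++ inr true :: q').
  have := @norm_block _ p' (s1 ++ inr true :: s2) q'; rewrite letters_cat /= negb_or ns1 ns2.
  by rewrite lead_cat //= orbT -!catA /= => ->.
have eza : z = (zp ++ s1) ++ inl a :: (s2 ++ zq) by rewrite ezz ezv -!catA.
set B := nt_of ((b, ops), pat (zp ++ inr true :: zq)).
apply: (@langN_rule _ _ newG _ (ins_at (zp ++ s1) (s2 ++ zq) a B)); last first.
  apply: sat_ins_atI; last by rewrite eu eza.
  rewrite !letters_cat (negPf ns1) (negPf ns2) orbF /= => lpq.
  exists (dec (norm (zp ++ inr true :: zq))); last by rewrite decK blk.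
  apply: IH; rewrite ?decK ?letters_cat //.
  by rewrite unmark_cat /= -/(unmark _) ep eq ew.
apply/rsP; split.
  have lt_j : nsep (norm (zp ++ s1)) < k.+1.
    rewrite ltnS; apply: leq_trans (good_nsep_norm gzm); rewrite eza norm_insert.
    case: (boolP (letters (zp ++ s1))) => lp; last by rewrite norm_nil.
    by rewrite !nsep_cat -!addnA leq_addr.
  by exists (Some (letters (zp ++ s1), letters (s2 ++ zq), trail false (zp ++ s1),
    lead (s2 ++ zq), Ordinal lt_j, a, B)).
have [ca ra] : correct new_rk k (ins_at (zp ++ s1) (s2 ++ zq) a B) /\
    trk new_rk (ins_at (zp ++ s1) (s2 ++ zq) a B) = nsep (norm z).
  rewrite eza; apply: ins_at_rank; rewrite ?blk -?eza ?good_nsep_norm //.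
  by rewrite /B es0 /= vs0 /= nsep_norm_pat.
have [na la] := ins_term_normal (Grammar new_rk [::] None) (nt_of (b, (j, v) :: ops, pat z))
  (letters (zp ++ s1)) (letters (s2 ++ zq)) (trail false (zp ++ s1)) (lead (s2 ++ zq))
  (nsep (norm (zp ++ s1))) a B.
split=> //=; first by rewrite ra es /= vs /= nsep_norm_pat.
(* [R] says that both halves come from one run, with [s1] and [s2] attached at the cut. *)
move=> y; pose R P Q := exists w' p' q', [/\ P = p' ++ s1, Q = s2 ++ q',
  seed (langN G) b w', unmark p' ++ None :: unmark q' = run ops (ext w') & pat p' = pat zp].
case/(@sat_ins_atE _ _ _ _ _ _ _ _ R).
- move=> y'; rewrite /B es0 /= vs0 => /state_langE[w' [p' [q' [sw' ew' pp pq ey]]]].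
  exists (p' ++ s1), (s2 ++ q'); rewrite blk !pat_cat pp pq; split=> //.
  by exists w', p', q'.
- by exists w, zp, zq; split=> //; rewrite ep eq ew.
- move=> P' [Q' [pP pQ [w' [p' [q' [eP eQ sw' ew' pp]]]] ey]].
  rewrite es /= vs; exists w', (P' ++ inl a :: Q'); split=> //=.
  + rewrite eP eQ -/(run _ _) -(runE w' p' q') // -ev ezv !unmark_cat /=.
    by rewrite !unmark_cat -!catA.
  + by rewrite eza pat_cat [RHS]pat_cat pP /= -!/(pat _) pQ.
Qed.

(** Induction on membership in [langN G]. The compiled run of a rule starts at a seed covered by the
    induction hypothesis, and the state at its end is subsumed by the state of [A] with no
    operations. *)
Lemma langN_complete A u : langN G A u -> forall z, unmark z = ext (enc u) -> letters z ->
  forall v, enc v = norm z -> langN newG (nt_of ((Some A, [::]), pat z)) v.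
Proof.
(* Keeping membership in [langN G] makes [L] ranked and its seeds genuine. *)
pose L A u := langN G A u /\ forall z, unmark z = ext (enc u) -> letters z ->
  forall v, enc v = norm z -> langN newG (nt_of ((Some A, [::]), pat z)) v.
suff: langN G A u -> L A u by move=> h /h[].
move: A u; apply: langN_least => A alpha u inr su.
have su' : sat (langN G) alpha u by apply: sat_mono su => ? ? [].
split; first exact: langN_rule inr su'.
move=> z ez lz v ev.
have [[b ops] in_items /= comp] := items_rules inr.
have rL : ranked (rk G) L by move=> B y [/ranked_langN].
have [fwd /(_ u su)[w sw rw]] := comp _ rL; have [ok _] := fwd w sw.
have sw' : seed (langN G) b w by case: (b) sw => // B [y [Ly _] ->]; exists y.
have gz : good k (unmark z) by rewrite ez -rw; case: (ops) ok => [|? ?] [].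
have [s es vs] := nt_of_some (items_NT A) gz.
have [s' es' vs'] := nt_of_some in_items gz.
apply: (@langN_subsume _ (nt_of ((b, ops), pat z))); first by rewrite es'.
- by rewrite es es' /= vs vs'.
- move=> y; rewrite es es' /= vs vs' => -[w' [z' [/= sw1 ez' pz' ey]]].
  have [fwd' _] := comp _ ranked_langN; have [_ [u' su1 ru']] := fwd' w' sw1.
  exists (enc u'), z'; split=> //=; last by rewrite ez' ru'.
  by exists u' => //; apply: langN_rule inr su1.
- apply: (langN_run in_items sw' ok) => //; last by rewrite rw.
  by move=> B eB z' ez' lz' y ey; move: sw; rewrite eB => -[y' [_ +] ew']; apply; rewrite -?ew'.
Qed.

Lemma lang_normal u : lang G u <-> lang newG u.
Proof.
split; last exact: langN_sound.
move=> lu; have := ranked_langN lu; rewrite dcfgG.1; case: u lu => x [|? ?] //= lu _.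
(* The empty word comes from the code [None]; any other word has a letter, as [langN_complete]
   requires. *)
case: x lu => [|a x] lu.
  apply: (@langN_rule _ _ newG _ (Leaf teps)) => //; apply/rsP; split; first by exists None.
  by split=> //= [|v ->//]; right; right; right.
set u := (_, _) in lu *.
pose z : seq (Sigma + bool) := inr false :: rcons (map inl u.1) (inr false).
have unmark_inl (s : seq Sigma) : unmark (map inl s : seq (Sigma + bool)) = map Some s.
  by elim: s => //= c s ->.
have ez : unmark z = ext (enc u).
  by rewrite /z /= /unmark map_rcons -/(unmark _) unmark_inl /enc cats0.
have eu : enc u = norm z.
  by rewrite norm_ends norm_rank0 unmark_inl ?nsep_letters // /enc cats0.
have gz : good k (unmark z) by rewrite ez good_ext nsep_enc.
have lz : letters z by [].
clearbody z.
have [s es vs] := nt_of_some (items_NT (start G)) gz.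
apply: (@langN_subsume _ (nt_of ((Some (start G), [::]), pat z))); first by rewrite es.
- by rewrite es /= vs /= nsep_norm_pat -eu nsep_enc.
(* In rank 0 the outer separators are the only ones, so normalization gives back the original
   word. *)
- move=> y; rewrite es /= vs => -[w [z' [[u' lu' ->] /= ez' _ ey]]].
  have [b1 [b2 [z'' [ezz ez'']]]] := unmark_ext ez'.
  have r0 : nsep (unmark z'') = 0 by rewrite ez'' nsep_enc (ranked_langN lu') dcfgG.1.
  by rewrite -(encK y) ey ezz norm_ends norm_rank0 // ez'' encK.
- exact: langN_complete lu _ ez lz _ eu.
Qed.

End NormalForm.

Theorem theorem2 (k : nat) (Sigma N : finType) (G : grammar Sigma N) :
  is_DCFG G k -> linear_grammar G ->
  exists (N' : finType) (G' : grammar Sigma N'),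
    [/\ is_DCFG G' k, normal_form G' & forall u, lang G u <-> lang G' u].
Proof.
move=> dcfgG linG; have [items [items_NT items_tail items_rules]] := items_exist dcfgG linG.
have [rs rsP] := sound_rules_exist G k items.
exists (newNT k items), (newG rs); split.
- by split=> // A alpha /rsP[_ []].
- by move=> A alpha /rsP[_ []].
- exact: lang_normal.
Qed.
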